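(* Let $1\le h\le n$, $0\le l\le n-1$, and set $A=2n+2h+2$, $B=n+2h+l+3$, $C=A-B=n-l-1$. For fixed $j,k$, let $(y_1,\dots,y_A)$ and $(z_1,\dots,z_B)$ be the roots (with multiplicity) in the variable $d$ of $P_{n,h}(j,k,\cdot)$ and $D_{n,h,l}(j,k,\cdot)$, and let $a_A$, $b_B$ be their respective leading coefficients. Then $$Q_{n,h,l}(j,k,d)=d^{A-B}\frac{a_A}{b_B}\sum_{i=0}^{A-B}\frac{(-1)^i}{d^i}\sum_{v=0}^i(-1)^v e_{i-v}(y_1,\dots,y_A)\,h_v(z_1,\dots,z_B)$$ $$=\frac{a_A}{b_B}\sum_{i=0}^{C}d^i(-1)^{C-i}\sum_{v=0}^{C-i}(-1)^v e_{C-i-v}(y_1,\dots,y_A)\,h_v(z_1,\dots,z_B).$$ In particular, the constant term coefficient of $Q_{n,h,l}(j,k,\cdot)$ is $$q_C^{(n,h)}(j,k)=(-1)^C\frac{(1-\theta)^h(\lambda\theta^2)^n}{\theta^h(\lambda\theta)}\sum_{v=0}^C(-1)^v e_{C-v}(y_1,\dots,y_A)\,h_v(z_1,\dots,z_B).$$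
   Context: $e_i$ and $h_i$ denote the $i$-th elementary and complete homogeneous symmetric polynomials. Fix $\lambda\in(0,1]$, $\theta\in(0,1)$. $(x)_N=x(x+1)\cdots(x+N-1)$ is the Pochhammer symbol. For integers $1\le h\le n$ and $0\le l\le n-1$ define polynomials in $d$, with coefficients that are polynomials in the variables $j,k$: $$P_{n,h}(j,k,d)=(d-2j-1)(d+2h-2j-1)(d-j)_h((1-\theta)d-j)_h(\lambda\theta d+h-n-j+k)_n(\theta d+h-n-j+k)_n,$$ $$D_{n,h,l}(j,k,d)=\lambda\theta\, d^{l+1}(d+h-2j-1)(\theta d-j)_h(d-n+h-2j-1+k)_{n+h+1}.$$ $Q_{n,h,l}(j,k,d)$ is the quotient in the polynomial long division, with respect to the variable $d$, of $P_{n,h}(j,k,d)$ by $D_{n,h,l}(j,k,d)$; it has degree $n-l-1$ in $d$ and is written $Q_{n,h,l}(j,k,d)=\sum_{i=0}^{n-l-1}q^{(n,h)}_{n-l-1-i}(j,k)d^i$. *)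

(* Defs.v *)
From HB Require Import structures.
From mathcomp Require Import all_boot all_order all_algebra.
From mathcomp Require Import mpoly.

Set Implicit Arguments.
Unset Strict Implicit.
Unset Printing Implicit Defensive.

Import Order.TTheory GRing.Theory Num.Theory.
Local Open Scope ring_scope.

Definition pochhammer (R : nzRingType) (x : R) (N : nat) : R :=
  \prod_(i < N) (x + i%:R).

(* Complete homogeneous symmetric polynomial h_k in n variables; the elementary
   one is mesym n R k. *)
Definition mcomplete (n : nat) (R : nzRingType) (k : nat) : {mpoly R[n]} :=
  \sum_(m : 'X_{1..n < k.+1} | mdeg m == k) 'X_[m].

(* s lists the roots of p lying in F, each with its multiplicity. *)
Definition roots_with_mult (F : fieldType) (p : {poly F}) (s : seq F) : Prop :=
  forall x : F, count_mem x s = mup x p.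

(* The polynomials in the variable d are elements of {poly {mpoly F[2]}}:
   univariate in d, with coefficients in F[j, k], where j and k are the two
   indeterminates of {mpoly F[2]}. *)
Section Polynomials.
Variables (F : numFieldType) (lambda theta : F).

Local Notation coef c := ((c%:MP)%:P : {poly {mpoly F[2]}}).
Local Notation j := (('X_(@ord0 1))%:P : {poly {mpoly F[2]}}).
Local Notation k := (('X_(@ord_max 1))%:P : {poly {mpoly F[2]}}).
Local Notation d := ('X : {poly {mpoly F[2]}}).

Definition Ppoly (n h : nat) : {poly {mpoly F[2]}} :=
  (d - 2%:R * j - 1) * (d + 2%:R * h%:R - 2%:R * j - 1)
  * pochhammer (d - j) h
  * pochhammer (coef (1 - theta) * d - j) h
  * pochhammer (coef (lambda * theta) * d + h%:R - n%:R - j + k) n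
  * pochhammer (coef theta * d + h%:R - n%:R - j + k) n.

Definition Dpoly (n h l : nat) : {poly {mpoly F[2]}} :=
  coef (lambda * theta) * d ^+ l.+1 * (d + h%:R - 2%:R * j - 1)
  * pochhammer (coef theta * d - j) h
  * pochhammer (d - n%:R + h%:R - 2%:R * j - 1 + k) (n + h + 1).

(* As polynomials in d over F[j, k]. The leading coefficient of Dpoly is the
   constant lambda * theta * theta ^+ h; if nonzero, it is a unit of
   F[j, k], so that %/ is the ordinary long division. *)
Definition Qpoly (n h l : nat) : {poly {mpoly F[2]}} :=
  Ppoly n h %/ Dpoly n h l.

(* Coefficients are numbered from the top: q_i is that of d^(n - l - 1 - i). *)
Definition qcoef (n h l i : nat) : {mpoly F[2]} :=
  (Qpoly n h l)`_(n - l - 1 - i).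

End Polynomials.

Definition jk_point (F : numFieldType) (j k : F) : 'I_2 -> F :=
  tnth [tuple j; k].

Definition at_jk (F : numFieldType) (p : {poly {mpoly F[2]}}) (j k : F) :
    {poly F} :=
  map_poly (meval (jk_point j k)) p.

(* Main.v *)
Require Import Defs.
From HB Require Import structures.
From mathcomp Require Import all_boot all_order all_algebra.
From mathcomp Require Import mpoly zify.

Set Implicit Arguments.
Unset Strict Implicit.
Unset Printing Implicit Defensive.

Import Order.TTheory GRing.Theory Num.Theory.
Local Open Scope ring_scope.

(** Write a monic polynomial of degree N with roots w in terms of its reversal
    E_w(t) = prod (1 - w_i t), whose coefficients are (-1)^s e_s(w): the
    coefficient of X^(N - s) in prod (X - w_i) is that of t^s in E_w
    ([coef_prod_XsubC_rev]).  Dividing a * prod (X - y_i) by b * prod (X - z_i)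
    from the top degree downwards is then, up to the factor a / b, dividing the power
    series E_y by E_z and keeping the terms of order at most C = A - B.  The
    inverse of E_z is sum_v h_v(z) t^v, so the coefficients of the quotient are
    the convolutions of (-1)^s e_s(y) with h_v(z).

    To stay inside polynomials, each geometric series 1 / (1 - z_i t) is cut after
    degree C.  The product of these sums still has the coefficients h_v(z) for
    v <= C ([coef_trunc_geom]) and inverts E_z modulo t^(C+1)
    ([prod_1sub_trunc_geom]), which is all that the C + 1 coefficients of the
    quotient see.  Hence prod (X - y_i) minus the candidate quotient times
    prod (X - z_i) has degree less than B ([size_viete_remainder]), and uniqueness
    of Euclidean division identifies the candidate ([divp_viete]).

    It remains to connect this with P, D and Q.  The long division takes place
    with coefficients in F[j, k]; the leading coefficient of D is there a unit, so
    specialising j and k commutes with the division ([rmorph_divp]).  Since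
    theta is neither 0 nor 1, the degrees of P and D are A and B for all j and k,
    so the given tuples exhaust all their roots and P and D split
    ([prod_XsubC_roots]). *)

(** * Elementary and complete symmetric polynomials as coefficients *)

(** Expanding the product, choosing -v_i X in the factors indexed by a set I
    contributes exactly the squarefree monomial of I, in degree #|I|. *)
Lemma coef_prod_1sub_mesym (R : comNzRingType) (n : nat) (v : 'I_n -> R) s :
  (\prod_(i < n) (1 - (v i)%:P * 'X))`_s = (-1) ^+ s * (mesym n R s).@[v].
Proof.
under eq_bigr do rewrite -mulNr -polyCN addrC.
rewrite bigA_distr /= coef_sum [mesym _ _ _]/mesym raddf_sum mulr_sumr /=.
rewrite [RHS]big_mkcond /=; apply: eq_bigr => I _.
rewrite -big_mkcondr /= big_split /= prodr_const -rmorph_prod coefCM coefXn.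
rewrite eq_sym; case: eqP => [<-|_]; last by rewrite mulr0.
rewrite mulr1 prodrN; congr (_ * _); rewrite rmorph_prod.
by apply: eq_bigr => i _; rewrite /= mevalXU.
Qed.

(** The generating series prod 1 / (1 - v_i X) of the complete symmetric
    polynomials, with each factor cut after degree N. *)
Definition trunc_geom (R : comNzRingType) (n N : nat) (v : 'I_n -> R) : {poly R} :=
  \prod_(i < n) \sum_(a < N.+1) ((v i)%:P * 'X) ^+ a.

(** Cutting after degree N is harmless up to degree N: the expanded product is
    indexed by the exponent vectors with entries at most N, and no entry of an
    exponent vector of total degree k <= N exceeds N. *)
Lemma coef_trunc_geom (R : comNzRingType) (n N : nat) (v : 'I_n -> R) k :
  (k <= N)%N -> (trunc_geom N v)`_k = (mcomplete n R k).@[v].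
Proof.
move=> le_kN; rewrite /trunc_geom bigA_distr_bigA /= coef_sum.
pose deg (f : {ffun 'I_n -> 'I_N.+1}) := (\sum_i (f i : nat))%N.
transitivity (\sum_(f : {ffun 'I_n -> 'I_N.+1} | deg f == k) \prod_i v i ^+ f i).
  rewrite [RHS]big_mkcond; apply: eq_bigr => f _.
  under eq_bigr do rewrite exprMn -rmorphXn.
  rewrite big_split /= -rmorph_prod -expr_sum coefCM coefXn eq_sym.
  by case: eqP; rewrite ?mulr1 ?mulr0.
pose m_of (f : {ffun 'I_n -> 'I_N.+1}) := [multinom (f i : nat) | i < n].
(* The default bm0 is reached only by functions f of degree greater than k, which
   the sum leaves out. *)
pose h' f : 'X_{1..n < k.+1} := insubd bm0 (m_of f).
pose h (m : 'X_{1..n < k.+1}) : {ffun 'I_n -> 'I_N.+1} := [ffun i => inord (m i)].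
have degm f : mdeg (m_of f) = deg f.
  by rewrite mdegE; apply: eq_bigr => i _; rewrite mnmE.
have hE (m : 'X_{1..n < k.+1}) i : h m i = m i :> nat.
  rewrite ffunE inordK // ltnS (leq_trans _ le_kN) // -ltnS.
  apply: leq_ltn_trans (bmdeg m); rewrite mdegE (bigD1 i) //=; exact: leq_addr.
have m_ofh m : m_of (h m) = m by apply/mnmP => i; rewrite mnmE hE.
rewrite (reindex_onto h h') /=; last first.
  move=> f /eqP df; apply/ffunP => i; apply: val_inj; rewrite [LHS]hE.
  by rewrite insubdK ?mnmE // -topredE /= degm df.
rewrite /mcomplete raddf_sum /=; apply: eq_big => [m|m _].
  rewrite -degm m_ofh andbC /h' m_ofh.
  suff -> : insubd bm0 (bmnm m) = m by rewrite eqxx.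
  by apply: val_inj; rewrite insubdK // -topredE /= bmdeg.
by rewrite mevalX; apply: eq_bigr => i _; rewrite hE.
Qed.

(** Factor by factor, (1 - t) (1 + t + ... + t^N) = 1 - t^(N+1) with t = v_i X, and
    being 1 modulo X^(N+1) is stable under products. *)
Lemma prod_1sub_trunc_geom (R : comNzRingType) (n N : nat) (v : 'I_n -> R) :
  exists W : {poly R},
    (\prod_(i < n) (1 - (v i)%:P * 'X)) * trunc_geom N v = 1 + 'X^(N.+1) * W.
Proof.
rewrite /trunc_geom -big_split /=.
elim/big_ind: _ => [|p q [U ->] [V ->]|i _].
- by exists 0; rewrite mulr0 addr0.
- exists (U + V + U * ('X^(N.+1) * V)); set t := 'X^(N.+1).
  by rewrite !(mulrDl, mulrDr) !(mul1r, mulr1) -!addrA [t * V + _]addrCA -mulrA.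
- exists (- (v i ^+ N.+1)%:P).
  by rewrite -[1 - _]opprB mulNr -subrX1 opprB exprMn -rmorphXn mulrN mulrC.
Qed.

(** * The quotient of two products of linear factors *)

(** Both sides are (-1)^s e_s(cs), the left one by Viete's formulas. *)
Lemma coef_prod_XsubC_rev (R : idomainType) (n : nat) (cs : n.-tuple R) s :
  (s <= n)%N ->
  (\prod_(c <- cs) ('X - c%:P))`_(n - s) =
  (\prod_(i < n) (1 - (tnth cs i)%:P * 'X))`_s.
Proof.
rewrite -ltnS => lt_sn.
by rewrite (mroots_coeff cs (Ordinal lt_sn)) coef_prod_1sub_mesym.
Qed.

Definition viete_quotient_coef (R : comNzRingType) (A B : nat) (y : 'I_A -> R)
    (z : 'I_B -> R) (i : nat) : R :=
  \sum_(0 <= v < i.+1)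
     (-1) ^+ v * (mesym A R (i - v)).@[y] * (mcomplete B R v).@[z].

(** The sign (-1)^i splits as (-1)^(i - v) (-1)^v, so the signed sum is the
    convolution of the coefficients of the two generating polynomials. *)
Lemma viete_quotient_coefE (R : comNzRingType) (A B N : nat) (y : 'I_A -> R)
    (z : 'I_B -> R) i : (i <= N)%N ->
  (-1) ^+ i * viete_quotient_coef y z i =
  (\prod_(a < A) (1 - (y a)%:P * 'X) * trunc_geom N z)`_i.
Proof.
move=> le_iN; rewrite coefMr /viete_quotient_coef big_mkord mulr_sumr.
apply: eq_bigr => v _; have le_vi : (v <= i)%N by rewrite -ltnS.
rewrite coef_prod_1sub_mesym coef_trunc_geom ?(leq_trans le_vi) //.
by rewrite -{1}(subnK le_vi) exprD -!mulrA signrMK.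
Qed.

Definition viete_quotient (R : comNzRingType) (A B : nat) (y : 'I_A -> R)
    (z : 'I_B -> R) (C : nat) : {poly R} :=
  \sum_(0 <= i < C.+1)
     'X ^+ i * (-1) ^+ (C - i) * (viete_quotient_coef y z (C - i))%:P.

Lemma coef0_viete_quotient (R : comNzRingType) (A B : nat) (y : 'I_A -> R)
    (z : 'I_B -> R) (C : nat) :
  (viete_quotient y z C)`_0 = (-1) ^+ C * viete_quotient_coef y z C.
Proof.
rewrite /viete_quotient big_nat_recl // expr0 mul1r subn0 coefD coef_sum.
rewrite -polyC1 -polyCN -polyC_exp -polyCM coefC /= big1 ?addr0 // => i _.
by rewrite -!mulrA coefXnM.
Qed.

(** In degree B + m, the product of the candidate quotient with prod (X - z_i) is
    the coefficient of order C - m of E_y G E_z, where G is the truncated inverse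
    of E_z.  As G E_z is 1 modulo t^(C+1), this is the coefficient of order C - m
    of E_y, that is, the coefficient of X^(B + m) in prod (X - y_i). *)
Lemma size_viete_remainder (R : idomainType) (B C : nat) (A := (B + C)%N)
    (y : A.-tuple R) (z : B.-tuple R) :
  (size (\prod_(c <- y) ('X - c%:P)
         - viete_quotient (tnth y) (tnth z) C * \prod_(c <- z) ('X - c%:P))%R
   <= B)%N.
Proof.
apply/leq_sizeP => i le_Bi; apply/eqP; rewrite coefB subr_eq0; apply/eqP.
rewrite -(subnKC le_Bi); set m := (i - B)%N.
set Ey := \prod_(a < A) (1 - (tnth y a)%:P * 'X).
set Ez := \prod_(b < B) (1 - (tnth z b)%:P * 'X).
set G := trunc_geom C (tnth z).
(* The s-th summand of the quotient, of degree C - s, meets degree B + m only if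
   s + m <= C, and then through the coefficient of X^(B - (C - m - s)) of the
   divisor.  If C - m - s > B there is no such coefficient, and E_z has none of
   order C - m - s either. *)
have termE (s : 'I_C.+1) :
    ('X ^+ (C - s) * (-1) ^+ s * (viete_quotient_coef (tnth y) (tnth z) s)%:P
     * \prod_(c <- z) ('X - c%:P))`_(B + m)
    = if (s < (C - m).+1)%N && (m <= C)%N then (Ey * G)`_s * Ez`_(C - m - s) else 0.
  have le_sC : (s <= C)%N by rewrite -ltnS.
  rewrite -(viete_quotient_coefE _ _ le_sC) -2!mulrA coefXnM.
  rewrite mulrA -polyC1 -polyCN -polyC_exp -polyCM coefCM.
  have szEz t : (B < t)%N -> Ez`_t = 0.
    by move=> ltBt; rewrite coef_prod_1sub_mesym mesym_geqnE // meval0 mulr0.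
  case: ifP => [lt|/negbT ge].
    case: ifP => // /andP[le_s le_m]; rewrite szEz ?mulr0 //; lia.
  rewrite -leqNgt in ge; case: ifP => [/andP[le_s le_m]|/negbT gt]; last first.
    rewrite nth_default ?mulr0 // size_prod_XsubC size_tuple; lia.
  rewrite -coef_prod_XsubC_rev; last by lia.
  by congr (_ * _`_ _); lia.
rewrite /viete_quotient big_mkord (reindex_inj rev_ord_inj) /=.
rewrite mulr_suml coef_sum.
under [RHS]eq_bigr => s _.
  have -> : (C - (C.+1 - s.+1) = s)%N by rewrite subSS subKn // -ltnS.
  rewrite subSS termE; over.
case: (leqP m C) => [le_mC|lt_Cm]; last first.
  rewrite [RHS]big1 => [|s _]; last by rewrite andbF.
  by rewrite nth_default // size_prod_XsubC size_tuple /A ltn_add2l.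
rewrite -[RHS]big_mkcond /=; under [RHS]eq_bigl do rewrite andbT.
rewrite -(big_ord_widen _ (fun s => (Ey * G)`_s * Ez`_(C - m - s))); last first.
  by rewrite ltnS leq_subr.
rewrite -coefM -mulrA [G * _]mulrC.
have [W ->] := prod_1sub_trunc_geom C (tnth z).
rewrite mulrDr mulr1 mulrCA coefD coefXnM ltnS leq_subr addr0.
rewrite -coef_prod_XsubC_rev; last by rewrite /A; lia.
by congr (_`_ _); rewrite /A; lia.
Qed.

Lemma divp_viete (F : fieldType) (B C : nat) (A := (B + C)%N)
    (y : A.-tuple F) (z : B.-tuple F) (a b : F) : b != 0 ->
  (a *: \prod_(c <- y) ('X - c%:P)) %/ (b *: \prod_(c <- z) ('X - c%:P)) =
  (a / b) *: viete_quotient (tnth y) (tnth z) C.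
Proof.
move=> nz_b; set Py := \prod_(c <- y) _; set Dz := \prod_(c <- z) _.
set T := viete_quotient _ _ _; apply/esym.
apply: (@Pdiv.Field.divpP _ _ _ _ (a *: (Py - T * Dz))).
  rewrite -scalerAl -scalerAr scalerA divfK //.
  by rewrite scalerBr addrC subrK.
rewrite (size_scale _ nz_b) [size Dz]size_prod_XsubC size_tuple ltnS.
apply: leq_trans (size_scale_leq _ _) _; exact: size_viete_remainder.
Qed.

(** * Splitting, specialisation and leading terms *)

(** Every listed root can be split off with its multiplicity; the degree
    hypothesis says that nothing but a constant is left in the end. *)
Lemma prod_XsubC_roots (F : fieldType) (p : {poly F}) (s : seq F) :
  size p = (size s).+1 -> roots_with_mult p s ->
  p = lead_coef p *: \prod_(x <- s) ('X - x%:P).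
Proof.
elim: s p => [|x s IHs] p /= sz_p rts.
  move/eqP: sz_p => /size_poly1P[c nz_c ->].
  by rewrite big_nil lead_coefC alg_polyC.
have nz_p : p != 0 by rewrite -size_poly_eq0 sz_p.
have : 'X - x%:P %| p by rewrite XsubC_dvd // -rts /= eqxx.
move=> /dvdpP[q Dp]; have nz_q : q != 0.
  by apply: contraNneq nz_p => q0; rewrite Dp q0 mul0r.
have nz_x : 'X - x%:P != 0 by rewrite polyXsubC_eq0.
rewrite big_cons Dp lead_coefM lead_coefXsubC mulr1.
rewrite scalerAr mulrC -IHs //.
  by apply/eqP; rewrite -eqSS -sz_p Dp size_Mmonic ?monicXsubC // size_XsubC addn2.
move=> t; have := rts t; rewrite Dp mupM // -['X - _]expr1 mup_XsubCX /=.
by case: eqVneq => _; rewrite /= ?addn1 ?addn0 // add1n => -[].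
Qed.

(** Pseudo-division by a polynomial with invertible leading coefficient is genuine
    Euclidean division.  Its defining identity is preserved by f, and so is the
    degree bound on the remainder, since f cannot kill the leading coefficient of
    the divisor. *)
Lemma rmorph_divp (R S : idomainType) (f : {rmorphism R -> S}) (p d : {poly R}) :
  lead_coef d \is a GRing.unit ->
  map_poly f (p %/ d) = map_poly f p %/ map_poly f d.
Proof.
move=> ud; have ufd : f (lead_coef d) \is a GRing.unit by rewrite rmorph_unit.
have nz_fd : f (lead_coef d) != 0 by apply: contraTneq ufd => ->; rewrite unitr0.
have nz_d : d != 0.
  by rewrite -lead_coef_eq0; apply: contraNneq nz_fd => ->; rewrite rmorph0.
apply: (@Pdiv.IdomainUnit.divpP _ _ _ _ _ (map_poly f (p %% d))).
- by rewrite lead_coef_map_eq.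
- by rewrite -rmorphM -rmorphD -Pdiv.IdomainUnit.divp_eq.
- by rewrite (size_map_poly_id0 nz_fd) (leq_ltn_trans (size_poly _ _)) ?ltn_modp.
Qed.

(** Degree and leading coefficient are tracked together, because over an integral
    domain the pair is multiplicative. *)
Definition lead_term (R : nzRingType) (N : nat) (c : R) (p : {poly R}) :=
  size p = N.+1 /\ lead_coef p = c.

Lemma lead_termX (R : nzRingType) : lead_term 1 1 ('X : {poly R}).
Proof. by split; rewrite ?size_polyX ?lead_coefX. Qed.

Lemma lead_termZX (R : idomainType) (c : R) : c != 0 -> lead_term 1 c (c%:P * 'X).
Proof.
by move=> nz_c; split; rewrite mul_polyC ?lead_coefZ ?lead_coefX ?mulr1 //
  size_scale ?size_polyX.
Qed.

Lemma lead_termC (R : nzRingType) (c : R) : c != 0 -> lead_term 0 c c%:P.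
Proof. by move=> nz_c; split; rewrite ?size_polyC ?nz_c ?lead_coefC. Qed.

(** Applied to the linear factors of P and D, where all terms in j, k, n and h are
    constants with respect to d. *)
Lemma lead_term_addC (R : nzRingType) N (c e : R) p :
  lead_term N.+1 c p -> lead_term N.+1 c (p + e%:P).
Proof.
move=> [sz_p lc_p]; have lt_e : (size e%:P < size p)%N.
  by rewrite sz_p ltnS (leq_trans (size_polyC_leq1 e)).
by split; rewrite ?size_polyDl ?lead_coefDl.
Qed.

Lemma lead_termM (R : idomainType) M N (b c : R) p q :
  lead_term M b p -> lead_term N c q -> lead_term (M + N) (b * c) (p * q).
Proof.
move=> [sz_p <-] [sz_q <-]; split; last by rewrite lead_coefM.
by rewrite size_mul -?size_poly_eq0 ?sz_p ?sz_q // addSn addnS.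
Qed.

Lemma lead_term_exp (R : idomainType) N (c : R) p m :
  lead_term N c p -> lead_term (N * m) (c ^+ m) (p ^+ m).
Proof.
move=> ltp; elim: m => [|m IHm].
  by rewrite muln0 !expr0; apply: lead_termC; apply: oner_neq0.
by rewrite mulnS !exprS; apply: lead_termM.
Qed.

Lemma lead_term_pochhammer (R : idomainType) N (c : R) p m :
  lead_term N.+1 c p -> lead_term (N.+1 * m) (c ^+ m) (pochhammer p m).
Proof.
move=> ltp; rewrite /pochhammer; elim: m => [|m IHm].
  by rewrite big_ord0 muln0 expr0; apply: lead_termC; apply: oner_neq0.
rewrite big_ord_recr mulnSr exprSr /=; apply: lead_termM => //.
by rewrite -polyC_natr; apply: lead_term_addC.
Qed.

Section LeadTerms.
Variables (F : numFieldType) (lambda theta : F).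
Hypotheses (nz_lambda : lambda != 0) (nz_theta : theta != 0).

Lemma lead_term_P n h : 1 - theta != 0 ->
  lead_term (2 * n + 2 * h + 2)
    (((1 - theta) ^+ h * (lambda * theta ^+ 2) ^+ n)%:MP) (Ppoly lambda theta n h).
Proof.
move=> nz_1theta.
have -> : (2 * n + 2 * h + 2 = 1 + 1 + 1 * h + 1 * h + 1 * n + 1 * n)%N by lia.
have -> : ((1 - theta) ^+ h * (lambda * theta ^+ 2) ^+ n)%:MP
   = 1 * 1 * 1 ^+ h * (1 - theta)%:MP ^+ h * (lambda * theta)%:MP ^+ n
     * theta%:MP ^+ n :> {mpoly F[2]}.
  rewrite expr1n !mul1r -mulrA -exprMn -mpolyCM -!rmorphXn -mpolyCM.
  by rewrite expr2 mulrA.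
rewrite /Ppoly -!polyC_natr -!polyC1 -!polyCM -!polyCN.
do !apply: lead_termM; try apply: lead_term_pochhammer;
 do ?apply: lead_term_addC; do ?[apply: lead_termX | apply: lead_termZX];
 by rewrite mpolyC_eq0 ?mulf_neq0.
Qed.

Lemma lead_term_D n h l :
  lead_term (n + 2 * h + l + 3)
    ((theta ^+ h * (lambda * theta))%:MP) (Dpoly lambda theta n h l).
Proof.
have -> : (n + 2 * h + l + 3 = 0 + 1 * l.+1 + 1 + 1 * h + 1 * (n + h + 1))%N by lia.
have -> : (theta ^+ h * (lambda * theta))%:MP
   = (lambda * theta)%:MP * 1 ^+ l.+1 * 1 * theta%:MP ^+ h * 1 ^+ (n + h + 1)
   :> {mpoly F[2]}.
  by rewrite !expr1n !mulr1 mulrC mpolyCM -rmorphXn.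
rewrite /Dpoly -!polyC_natr -!polyC1 -!polyCM -!polyCN.
do !apply: lead_termM; try apply: lead_term_pochhammer;
  try apply: lead_term_exp;
 do ?apply: lead_term_addC;
 do ?[apply: lead_termX | apply: lead_termZX | apply: lead_termC];
 by rewrite mpolyC_eq0 ?mulf_neq0.
Qed.

End LeadTerms.

(** The leading coefficients of P and D do not involve j and k, so they survive
    every specialisation. *)
Lemma lead_term_at_jk (F : numFieldType) (p : {poly {mpoly F[2]}}) N c (j k : F) :
  c != 0 -> lead_term N c%:MP p -> lead_term N c (at_jk p j k).
Proof.
move=> nz_c [sz_p lc_p]; have nz : (lead_coef p).@[jk_point j k] != 0.
  by rewrite lc_p mevalC.
by split; [rewrite size_map_poly_id0 | rewrite lead_coef_map_eq //= lc_p mevalC].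
Qed.

Theorem proposition2 (F : numFieldType) (lambda theta : F)
    (hlambda : 0 < lambda <= 1) (htheta : 0 < theta < 1)
    (n h l : nat) (hh : (1 <= h <= n)%N) (hl : (l <= n - 1)%N) (j k : F) :
  let A := (2 * n + 2 * h + 2)%N in
  let B := (n + 2 * h + l + 3)%N in
  let C := (n - l - 1)%N in
  let P := at_jk (Ppoly lambda theta n h) j k in
  let D := at_jk (Dpoly lambda theta n h l) j k in
  let Q := at_jk (Qpoly lambda theta n h l) j k in
  forall (y : A.-tuple F) (z : B.-tuple F),
  roots_with_mult P y -> roots_with_mult D z ->
  let a_A := lead_coef P in
  let b_B := lead_coef D in
  let e i := (mesym A F i).@[tnth y] in
  let hs i := (mcomplete B F i).@[tnth z] in
  [/\ (* in the field of rational functions F(d) *)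
      tofrac Q
      = tofrac 'X ^+ (A - B) * tofrac (a_A / b_B)%:P
        * \sum_(0 <= i < (A - B).+1)
            (-1) ^+ i / tofrac 'X ^+ i
            * tofrac (\sum_(0 <= v < i.+1) (-1) ^+ v * e (i - v)%N * hs v)%:P,
      Q = (a_A / b_B)%:P
          * \sum_(0 <= i < C.+1)
              'X ^+ i * (-1) ^+ (C - i)
              * (\sum_(0 <= v < (C - i).+1)
                   (-1) ^+ v * e (C - i - v)%N * hs v)%:P
    & (qcoef lambda theta n h l C).@[jk_point j k]
      = (-1) ^+ C
        * ((1 - theta) ^+ h * (lambda * theta ^+ 2) ^+ n
           / (theta ^+ h * (lambda * theta)))
        * \sum_(0 <= v < C.+1) (-1) ^+ v * e (C - v)%N * hs v].
Proof.
move=> A B C P D Q y z rtsP rtsD a_A b_B e hs.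
have [/andP[lambda_gt0 _] /andP[theta_gt0 theta_lt1]] := (hlambda, htheta).
have nz_lambda : lambda != 0 by rewrite gt_eqF.
have nz_theta : theta != 0 by rewrite gt_eqF.
have nz_1theta : 1 - theta != 0 by rewrite subr_eq0 gt_eqF.
have ltD := lead_term_D nz_lambda nz_theta n h l.
have nz_b : theta ^+ h * (lambda * theta) != 0 by rewrite !mulf_neq0 ?expf_neq0.
have nz_a : (1 - theta) ^+ h * (lambda * theta ^+ 2) ^+ n != 0.
  by rewrite !(mulf_neq0, expf_neq0).
have [szP lcP] := lead_term_at_jk j k nz_a
  (lead_term_P nz_lambda nz_theta n h nz_1theta).
have [szD lcD] := lead_term_at_jk j k nz_b ltD.
have eqC : (A - B = C)%N by rewrite /A /B /C; lia.
have eqA : A = (B + C)%N by rewrite /A /B /C; lia.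
have QE : Q = (a_A / b_B) *: viete_quotient (tnth y) (tnth z) C.
  rewrite /Q /at_jk /Qpoly rmorph_divp; last first.
    by rewrite ltD.2 rmorph_unit // unitfE.
  rewrite -/(at_jk _ j k) -/(at_jk (Dpoly _ _ _ _ _) j k) -/P -/D.
  rewrite [P in P %/ _](@prod_XsubC_roots _ _ y) ?size_tuple //.
  rewrite [D](@prod_XsubC_roots _ _ z) ?size_tuple // -/a_A -/b_B.
  have nz_bB : b_B != 0 by rewrite /b_B lcD.
  clear -eqA nz_bB; clearbody a_A b_B A B C; subst A; exact: divp_viete.
split.
- (* The two forms differ by the reversal i |-> C - i of the sum. *)
  rewrite QE -mul_polyC /viete_quotient rmorphM rmorph_sum /= [LHS]mulrC.
  rewrite [RHS]mulrAC; congr (_ * _); rewrite eqC big_nat_rev mulr_sumr /=.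
  apply: eq_big_nat => i /andP[_ lt_iC]; rewrite add0n subSS subKn //.
  rewrite !rmorphM !rmorphXn rmorphN rmorph1 /= !mulrA; congr (_ * _).
  rewrite mulrAC; congr (_ * _).
  have nz_X : tofrac ('X : {poly F}) != 0 by rewrite tofrac_eq0 polyX_eq0.
  by rewrite expfB_cond // (negbTE nz_X) add0n -ltnS.
- by rewrite QE -mul_polyC.
- rewrite /qcoef -coef_map.
  have -> : (n - l - 1 - C = 0)%N by rewrite subnn.
  rewrite -/(at_jk _ j k) -/Q QE coefZ coef0_viete_quotient /a_A /b_B lcP lcD.
  by rewrite mulrCA [LHS]mulrA.
Qed.
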